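(* Let $f:\mathbb{H}^n\to\mathbb{R}$ be h-convex and $L$-Lipschitz on $\mathbb{H}^n$, and let $f^*=\min_{x\in\bar B(p,r)}f(x)$. For $\delta\in(0,1)$, there is an algorithm which finds $x\in\mathbb{H}^n$ satisfying $f(x)-f^*\le L\delta$ using at most $$O\Big(\log(r)+n^2\log\Big(\frac1\delta\Big)\Big)$$ subgradient queries.
   Context: $\mathbb{H}^n$ is $n$-dimensional hyperbolic space (complete, simply connected, constant sectional curvature $-1$), with distance $d(\cdot,\cdot)$ and exponential map $\exp_y$ at $y$; $\bar B(p,r)$ is the closed geodesic ball with center $p\in\mathbb{H}^n$ and radius $r$. A function $f$ is $L$-Lipschitz if $|f(x)-f(y)|\le L\,d(x,y)$ for all $x,y$. For $y\in\mathbb{H}^n$ and a unit tangent vector $u$ at $y$, $B_{y,u}(x)=\lim_{t\to\infty}\big(d(\exp_y(-tu),x)-t\big)$; for $s\ge 0$, $B_{y,su}:=sB_{y,u}$ (so $B_{y,0}=0$). $\partial^{\mathsf h}f(y)$ is the set of tangent vectors $v$ at $y$ with $f(x)-f(y)\ge B_{y,v}(x)$ for all $x\in\mathbb{H}^n$ (the h-subgradients of $f$ at $y$); $f$ is h-convex if $\partial^{\mathsf h}f(y)\neq\emptyset$ for all $y\in\mathbb{H}^n$. The algorithm accesses $f$ only through subgradient queries: a query at a point $x\in\mathbb{H}^n$ returns the value $f(x)$ and an element of $\partial^{\mathsf h}f(x)$. The cost counted is the number of queries. $O(\cdot)$ hides an absolute constant.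
   Formalization: The query bound is proved as O(max(1, log(r) + n² log(1/δ))), since the expression can be negative or arbitrarily close to 0 (e.g. n = 1, r = 1, δ near 1), where the literal bound would allow no queries and is false. *)

(* Defs.v *)
From HB Require Import structures.
From mathcomp Require Import all_boot all_order all_algebra.
From mathcomp Require Import all_classical all_reals all_analysis.
Import Order.TTheory GRing.Theory Num.Theory.
Import numFieldNormedType.Exports.

Set Implicit Arguments.
Unset Strict Implicit.
Unset Printing Implicit Defensive.

Local Open Scope classical_set_scope.
Local Open Scope ring_scope.

(* Hyperbolic n-space is realised as the upper sheet
   of the hyperboloid <x, x> = -1 in R^(n+1) with the Minkowski form
   <x, y> = - x_0 y_0 + x_1 y_1 + ... + x_n y_n, whose restriction to the
   tangent spaces { v | <y, v> = 0 } is the Riemannian metric of curvature -1. *)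

Definition cosh {R : realType} (t : R) : R := (expR t + expR (- t)) / 2.
Definition sinh {R : realType} (t : R) : R := (expR t - expR (- t)) / 2.
Definition arcosh {R : realType} (z : R) : R := ln (z + Num.sqrt (z ^+ 2 - 1)).

Definition mink {R : realType} {n : nat} (x y : 'rV[R]_n.+1) : R :=
  - (x 0 ord0 * y 0 ord0) +
  \sum_(i < n) x 0 (lift ord0 i) * y 0 (lift ord0 i).

Record hspace (R : realType) (n : nat) := HSpace {
  hcoord :> 'rV[R]_n.+1;
  hcoordP : (mink hcoord hcoord == -1) && (0 < hcoord 0 ord0) }.

HB.instance Definition _ (R : realType) (n : nat) :=
  [isSub for @hcoord R n].
HB.instance Definition _ (R : realType) (n : nat) :=
  [Choice of hspace R n by <:].

Section HyperbolicGeometry.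
Context {R : realType} {n : nat}.
Implicit Types (x y v : 'rV[R]_n.+1) (p : hspace R n) (f : hspace R n -> R).

Definition hdist x y : R := arcosh (- mink x y).

Definition hball p (r : R) : set (hspace R n) := [set x | hdist p x <= r].

Definition tangent y v : Prop := mink y v = 0.

(* Meaningful for tangent vectors, on which mink is positive definite. *)
Definition hnorm v : R := Num.sqrt (mink v v).

(* At v = 0 the value is y, because 0^-1 = 0. *)
Definition hexp y v : 'rV[R]_n.+1 :=
  cosh (hnorm v) *: y + (sinh (hnorm v) / hnorm v) *: v.

(* For y in the hyperboloid, u a unit tangent vector at y and x in the
   hyperboloid, the limit exists and equals ln (<u, x> - <y, x>). *)
Definition busemann_unit y u x : R :=
  lim ((hdist (hexp y (- t *: u)) x - t) @[t --> +oo]).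

(* B_{y, s u} = s B_{y, u} with s = |v| and u = v / |v|; it is 0 at v = 0. *)
Definition busemann y v x : R :=
  hnorm v * busemann_unit y ((hnorm v)^-1 *: v) x.

Definition hsubgradient f (y : hspace R n) v : Prop :=
  tangent y v /\ forall x : hspace R n, busemann y v x <= f x - f y.

Definition hconvex f : Prop :=
  forall y : hspace R n, exists v, hsubgradient f y v.

Definition hlipschitz (L : R) f : Prop :=
  forall x y : hspace R n, `|f x - f y| <= L * hdist x y.

Definition is_minimum (A : set R) (m : R) : Prop := A m /\ lbound A m.

End HyperbolicGeometry.

(* A deterministic adaptive algorithm is a well-founded decision tree: it either
   stops with an answer, or queries a point and continues with a tree that
   depends on the value and the subgradient (as a vector of R^(n+1)) returned. *)
Inductive algorithm (R : realType) (n : nat) : Type :=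
| Output (x : hspace R n)
| Query (x : hspace R n) (next : R -> 'rV[R]_n.+1 -> algorithm R n).

(* alg_run f A m z: some run of A on f makes exactly m queries and answers z.
   The choice of the subgradient is left to the oracle, which need not repeat
   its answer when a point is queried again. *)
Inductive alg_run {R : realType} {n : nat} (f : hspace R n -> R) :
    algorithm R n -> nat -> hspace R n -> Prop :=
| run_output (x : hspace R n) : alg_run f (Output x) 0 x
| run_query (x : hspace R n) (next : R -> 'rV[R]_n.+1 -> algorithm R n)
    (v : 'rV[R]_n.+1) (m : nat) (z : hspace R n) :
    hsubgradient f x v -> alg_run f (next (f x) v) m z ->
    alg_run f (Query x next) m.+1 z.

(* The tree is well founded, so the oracle's answers always lead to an output. *)
Lemma alg_run_ex {R : realType} {n : nat} (f : hspace R n -> R)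
    (A : algorithm R n) :
  hconvex f -> exists m z, alg_run f A m z.
Proof.
move=> cf; elim: A => [x|x next IH]; first by exists 0%N, x; constructor.
have [v xv] := cf x; have [m [z run]] := IH (f x) v.
by exists m.+1, z; apply: run_query xv run.
Qed.

(* Main.v *)
Require Import Defs.
From mathcomp Require Import all_boot all_order all_algebra.
From mathcomp Require Import all_classical all_reals all_analysis.
From mathcomp Require Import ring lra.
Import Order.TTheory GRing.Theory Num.Theory.
Import numFieldNormedType.Exports.
Local Open Scope classical_set_scope.
Local Open Scope ring_scope.

Set Implicit Arguments.
Unset Strict Implicit.
Unset Printing Implicit Defensive.

(** A subgradient v at y is a cut by a horoball, not merely by a half-space: a
    point x with f x <= f y has B_{y,v}(x) <= 0, and since
    B_{y,u}(x) = ln (<u, x> - <y, x>) for a unit tangent u ([busemannE]), this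
    says <u, x> - <y, x> <= 1 ([subgradient_horoball]).  Two methods exploit this,
    both localizing a minimizer x* of the ball until it is certainly close to a
    queried point.  Each keeps a region that loses no point better than the best
    query so far; [cutting_run] is this common scheme.

    Large radius.  Describe a ball about c by K, the hyperbolic cosine of its
    radius: it is the set -<c, x> <= K.  The part of it inside the horoball through
    c lies in a ball about a point of the geodesic from c in direction -u, and the
    best choice of that point gives K' = sqrt (2 K - 1) exactly ([ball_cut]).  For
    large K this halves ln K, so about log2 r steps bring K below an absolute
    constant, and an absolute number of further steps bring it to at most 65/64
    ([shrink_steps]), i.e. the radius to at most 1/2.  If delta >= 1/2 the centre is then
    good enough, which is why no power of n enters when ln (1 / delta) is tiny.

    Small radius.  In the Klein chart at the final centre
    the horoball lies in the half-space <v, x> <= 0, whose trace is a Euclidean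
    half-space bounded by a hyperplane through the queried point
    ([horoball_chart]).  Hence the ellipsoid method applies.  If every query
    were worse than f x* + L delta, the points of the chart at distance delta / 4
    from x* along the axes, whose values are at most f x* + L delta by the
    Lipschitz bound, would never be cut off.  An ellipsoid that contains them is
    large ([ell_det_le], by Hadamard's inequality), while every step divides the
    squared volume by at least 1 + 1 / (n + 1) ([ell_cut_det]); this bounds the
    number of steps by a multiple of n^2 log (radius / delta) ([ell_steps]).

    The two counts fit the budget because the trivial answer p settles r <= delta;
    for r > delta the possibly negative ln r is dominated by ln (1 / delta) when
    n >= 2, and for n = 1 it is matched by starting the ellipsoid method at radius
    proportional to r ([ell_steps_budget]). *)

(** * Euclidean inner product and determinants *)

Definition dot {R : realType} {n : nat} (z w : 'rV[R]_n) : R := (z *m w^T) 0 0.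

Lemma dotE (R : realType) n (z w : 'rV[R]_n) :
  dot z w = \sum_(i < n) z 0 i * w 0 i.
Proof. by rewrite /dot mxE; apply: eq_bigr => i _; rewrite mxE. Qed.

Lemma dotC (R : realType) n (z w : 'rV[R]_n) : dot z w = dot w z.
Proof. by rewrite !dotE; apply: eq_bigr => i _; rewrite mulrC. Qed.

Lemma dotDl (R : realType) n (z z' w : 'rV[R]_n) :
  dot (z + z') w = dot z w + dot z' w.
Proof. by rewrite /dot mulmxDl mxE. Qed.

Lemma dotZl (R : realType) n (k : R) (z w : 'rV[R]_n) :
  dot (k *: z) w = k * dot z w.
Proof. by rewrite /dot -scalemxAl mxE. Qed.

Lemma dotNl (R : realType) n (z w : 'rV[R]_n) : dot (- z) w = - dot z w.
Proof. by rewrite -scaleN1r dotZl mulN1r. Qed.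

Lemma dotDr (R : realType) n (z w w' : 'rV[R]_n) :
  dot z (w + w') = dot z w + dot z w'.
Proof. by rewrite dotC dotDl !(dotC z). Qed.

Lemma dotZr (R : realType) n (k : R) (z w : 'rV[R]_n) :
  dot z (k *: w) = k * dot z w.
Proof. by rewrite dotC dotZl dotC. Qed.

Lemma dotNr (R : realType) n (z w : 'rV[R]_n) : dot z (- w) = - dot z w.
Proof. by rewrite dotC dotNl dotC. Qed.

Definition dot_lin := (dotDl, dotDr, dotNl, dotNr, dotZl, dotZr).

Lemma dot0l (R : realType) n (w : 'rV[R]_n) : dot 0 w = 0.
Proof. by rewrite /dot mul0mx mxE. Qed.

Lemma dot_mulmxr (R : realType) n m (A : 'M[R]_(m, n)) z w :
  dot (z *m A) w = dot z (w *m A^T).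
Proof. by rewrite /dot trmx_mul trmxK mulmxA. Qed.

Lemma dot_ge0 (R : realType) n (z : 'rV[R]_n) : 0 <= dot z z.
Proof. by rewrite dotE; apply: sumr_ge0 => i _; rewrite -expr2 sqr_ge0. Qed.

Lemma dot_eq0 (R : realType) n (z : 'rV[R]_n) : (dot z z == 0) = (z == 0).
Proof.
apply/idP/eqP => [|->]; last by rewrite dot0l.
rewrite dotE psumr_eq0 => [|i _]; last by rewrite -expr2 sqr_ge0.
move=> /allP h; apply/rowP => i; rewrite mxE; apply/eqP.
by have := h i; rewrite mem_index_enum mulf_eq0 orbb => /(_ isT).
Qed.

Lemma dot_gt0 (R : realType) n (z : 'rV[R]_n) : z != 0 -> 0 < dot z z.
Proof. by move=> z0; rewrite lt_neqAle dot_ge0 andbT eq_sym dot_eq0. Qed.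

Lemma cauchy_schwarz (R : realType) n (z w : 'rV[R]_n) :
  dot z w ^+ 2 <= dot z z * dot w w.
Proof.
have [->|w0] := eqVneq w 0; first by rewrite dotC dot0l dot0l mulr0 expr0n.
have := dot_ge0 (dot w w *: z - dot z w *: w).
have -> : dot (dot w w *: z - dot z w *: w) (dot w w *: z - dot z w *: w) =
    dot w w * (dot z z * dot w w - dot z w ^+ 2).
  by rewrite !dot_lin (dotC w z); ring.
by rewrite pmulr_rge0 ?dot_gt0// subr_ge0.
Qed.

(** Induction on the rows: subtracting from the other rows their projections on
    the first one is a Schur complement, which splits the Gram determinant and
    can only shorten the rows. *)
Lemma det_gram_le (R : realType) m n (B : 'M[R]_(m, n)) :
  \det (B *m B^T) <= \prod_(i < m) dot (row i B) (row i B).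
Proof.
elim: m B => [|m IH] B; first by rewrite det_mx00 big_ord0.
rewrite -[m.+1]/(1 + m)%N in B *.
rewrite -(vsubmxK B); set u := usubmx B; set D := dsubmx B.
rewrite big_split_ord big_ord1 /=.
have ru : row (lshift m 0) (col_mx u D) = u.
  by rewrite rowKu; apply/rowP => j; rewrite mxE.
rewrite ru; under eq_bigr => i _ do rewrite rowKd.
rewrite tr_col_mx mul_col_row.
have [u0|u0] := eqVneq u 0.
  by rewrite u0 dot0l mul0r !mul0mx det_lblock det_mx11 mxE !mul0r.
have du := dot_gt0 u0.
pose k := D *m u^T; pose D' := D - (dot u u)^-1 *: (k *m u).
have uu : u *m u^T = (dot u u)%:M by rewrite [LHS]mx11_scalar.
have D'u : D' *m u^T = 0.
  rewrite /D' mulmxBl -scalemxAl -mulmxA uu mul_mx_scalar scalerA mulVf ?gt_eqF//.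
  by rewrite scale1r subrr.
have DD' : D *m D^T = D' *m D'^T + (dot u u)^-1 *: (k *m k^T).
  have Dk : D = D' + (dot u u)^-1 *: (k *m u) by rewrite subrK.
  have uD' : u *m D'^T = 0 by rewrite -[u]trmxK -trmx_mul D'u trmx0.
  rewrite {1 2}Dk linearD linearZ /= trmx_mul mulmxDl !mulmxDr.
  rewrite -!scalemxAr -!scalemxAl !mulmxA D'u -(mulmxA k u D'^T) uD'.
  rewrite mul0mx mulmx0 !scaler0 addr0 add0r -(mulmxA k u) uu mul_mx_scalar.
  by rewrite -!scalemxAl !scalerA divfK ?gt_eqF.
have -> : block_mx (u *m u^T) (u *m D^T) (D *m u^T) (D *m D^T) =
    block_mx 1%:M 0 ((dot u u)^-1 *: k) 1%:M *m
    block_mx (u *m u^T) (u *m D^T) 0 (D' *m D'^T).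
  rewrite mulmx_block !mul1mx !mul0mx !addr0 uu mul_mx_scalar scalerA.
  rewrite divff ?gt_eqF// scale1r DD' -scalemxAl.
  have -> : k^T = u *m D^T by rewrite /k trmx_mul trmxK.
  by rewrite addrC.
rewrite det_mulmx det_lblock !det1 !mul1r det_ublock uu det_scalar1.
apply: ler_wpM2l; first exact: dot_ge0.
apply: le_trans (IH D') _; apply: ler_prod => i _; rewrite dot_ge0 /=.
rewrite /D' linearB /= linearZ /= row_mul.
set x := row i D; have ki : row i k = (dot x u)%:M.
  by rewrite /k row_mul [LHS]mx11_scalar.
rewrite ki mul_scalar_mx scalerA -subr_ge0.
set y := x - _.
have -> : dot x x - dot y y = dot x u ^+ 2 / dot u u.
  by rewrite /y !dot_lin (dotC u x); field; rewrite gt_eqF.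
by rewrite divr_ge0 ?sqr_ge0// ltW.
Qed.

Lemma hadamard (R : realType) n (B : 'M[R]_n) :
  \det B ^+ 2 <= \prod_(i < n) dot (row i B) (row i B).
Proof. by have := det_gram_le B; rewrite det_mulmx det_tr -expr2. Qed.

(** The matrix determinant lemma, from the two block factorizations of one
    bordered matrix.  The factor b on the left keeps the exponent of b equal
    to n. *)
Lemma det_add_rank1 (R : realType) n (b c : R) (h : 'rV[R]_n) : b != 0 ->
  \det (b%:M + c *: (h^T *m h)) * b = b ^+ n * (b + c * dot h h).
Proof.
move=> b0.
pose A : 'M[R]_(1 + n) := block_mx 1%:M (- h) (c *: h^T) b%:M.
have hh : h *m h^T = (dot h h)%:M by rewrite [LHS]mx11_scalar.
have e1 : A = block_mx 1%:M 0 (c *: h^T) 1%:M *m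
              block_mx 1%:M (- h) 0 (b%:M + c *: (h^T *m h)).
  rewrite mulmx_block !mul1mx !mul0mx !mulmx1 !addr0.
  congr block_mx; rewrite mulmxN -scalemxAl addrC addrK //.
have e2 : A = block_mx 1%:M (- b^-1 *: h) 0 1%:M *m
              block_mx (1%:M + (c / b) *: (h *m h^T)) 0 (c *: h^T) b%:M.
  rewrite mulmx_block !mul1mx !mul0mx !add0r mul_mx_scalar scalerA mulrN divff//.
  rewrite scaleN1r -scalemxAl -scalemxAr scalerA; congr block_mx.
  by rewrite mulNr mulrC scaleNr addrK.
have : \det A = \det A by []; rewrite {1}e1 e2 !det_mulmx !det_lblock !det_ublock.
rewrite !det1 !mul1r hh scale_scalar_mx -raddfD det_scalar1 det_scalar => ->.
by field.
Qed.

(** * The ellipsoid step *)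

Lemma bernoulli_ineq (R : realFieldType) (x : R) m :
  -1 <= x -> 1 + m%:R * x <= (1 + x) ^+ m.
Proof.
move=> x1; elim: m => [|m IH]; first by rewrite mul0r addr0 expr0.
rewrite exprS; apply: le_trans (ler_wpM2l _ IH); last by lra.
rewrite -subr_ge0 -natr1.
have -> : (1 + x) * (1 + m%:R * x) - (1 + (m%:R + 1) * x) = m%:R * x ^+ 2 by ring.
by rewrite mulr_ge0// sqr_ge0.
Qed.

(** The pair (c, B) stands for the preimage of the unit ball under
    z |-> (z - c) B.  Working with B rather than with the quadratic form B B^T
    makes positivity automatic. *)
Definition ellipsoid {R : realType} {n : nat} (s : 'rV[R]_n * 'M[R]_n) : set 'rV[R]_n :=
  [set z | dot ((z - s.1) *m s.2) ((z - s.1) *m s.2) <= 1].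

Section EllipsoidStep.
Context {R : realType} {n : nat}.
Let N : R := n.+1%:R.

(** The classical parameters of the minimal ellipsoid around a half-ball, but for
    dimension n + 1 instead of n: the half-ball is still covered, and
    [ell_short] stays nonzero in dimension 1, where the classical one vanishes. *)
Definition ell_long : R := (N + 1) / N.
Definition ell_short : R := Num.sqrt (1 - N^-1 ^+ 2).

(** The unit normal of the cut in the coordinates where the ellipsoid is a ball. *)
Definition ell_dir (g : 'rV[R]_n) (B : 'M[R]_n) : 'rV[R]_n :=
  let h := g *m (invmx B)^T in (Num.sqrt (dot h h))^-1 *: h.

Definition ell_cut (g : 'rV[R]_n) (s : 'rV[R]_n * 'M[R]_n) : 'rV[R]_n * 'M[R]_n :=
  let h := ell_dir g s.2 in
  (s.1 - (N + 1)^-1 *: (h *m invmx s.2),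
   s.2 *m (ell_short%:M + (ell_long - ell_short) *: (h^T *m h))).

Let N_ge1 : 1 <= N. Proof. by rewrite /N ler1n. Qed.
Let N_gt0 : 0 < N. Proof. exact: lt_le_trans N_ge1. Qed.

Lemma ell_short_sqr : ell_short ^+ 2 = 1 - N^-1 ^+ 2.
Proof. by rewrite sqr_sqrtr// subr_ge0 expr_le1 ?invr_ge0 ?(ltW N_gt0)// invf_le1. Qed.

Lemma ell_dir_unit g (B : 'M[R]_n) : g != 0 -> B \in unitmx ->
  dot (ell_dir g B) (ell_dir g B) = 1.
Proof.
move=> g0 Bu; rewrite /ell_dir; set h := g *m _.
have h0 : h != 0.
  apply: contraNneq g0 => h0.
  have : h *m B^T = g by rewrite /h -mulmxA -trmx_mul mulmxV// trmx1 mulmx1.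
  by rewrite h0 mul0mx => <-.
rewrite dotZl dotZr mulrA -invfM -expr2 sqr_sqrtr ?dot_ge0//.
by rewrite mulVf// gt_eqF// dot_gt0.
Qed.

(** With t the coordinate of z along the cut normal, the defect of the new
    inequality is at least a positive multiple of - t (1 + t), and the cut says
    that t lies in [-1, 0]. *)
Lemma ell_cut_sub g s z : g != 0 -> s.2 \in unitmx ->
  ellipsoid s z -> dot g (z - s.1) <= 0 -> ellipsoid (ell_cut g s) z.
Proof.
case: s => c B /= g0 Bu; rewrite /ellipsoid /ell_cut /=.
have := ell_dir_unit g0 Bu; set h := ell_dir g B => hh.
set w := (z - c) *m B => w1 gz.
have t0 : dot w h <= 0.
  have -> : dot w h = (Num.sqrt (dot (g *m (invmx B)^T) (g *m (invmx B)^T)))^-1 *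
      dot g (z - c).
    by rewrite dotZr -(dot_mulmxr _ w) /w -(mulmxA _ B) mulmxV// mulmx1 (dotC g).
  by rewrite mulr_ge0_le0// invr_ge0 sqrtr_ge0.
(* Hides the body of h, which is itself a multiple, from the bilinearity rules. *)
clearbody h.
have t1 : -1 <= dot w h.
  have := cauchy_schwarz w h; rewrite hh mulr1 => /le_trans/(_ w1) t1.
  have : `|dot w h| <= 1 by rewrite -(@expr_le1 _ 2)// real_normK ?num_real.
  by rewrite ler_norml => /andP[].
have -> : (z - (c - (N + 1)^-1 *: (h *m invmx B))) *m
    (B *m (ell_short%:M + (ell_long - ell_short) *: (h^T *m h))) =
    ell_short *: (w + (N + 1)^-1 *: h) +
    ((ell_long - ell_short) * (dot w h + (N + 1)^-1)) *: h.
  rewrite opprB addrCA addrC mulmxA mulmxDl -scalemxAl -mulmxA mulVmx// mulmx1 -/w.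
  rewrite mulmxDr mul_mx_scalar -scalemxAr mulmxA -scalerA; congr (_ + _ *: _).
  rewrite mulmxDl -scalemxAl [w *m h^T]mx11_scalar [h *m h^T]mx11_scalar.
  rewrite -/(dot w h) -/(dot h h) hh scale_scalar_mx -raddfD mul_scalar_mx mulr1.
  by [].
set v := _ + _ *: h; have -> : dot v v = ell_short ^+ 2 * (dot w w - dot w h ^+ 2) +
    ell_long ^+ 2 * (dot w h + (N + 1)^-1) ^+ 2.
  by rewrite /v !dot_lin (dotC h w) hh; ring.
have c0 : 0 <= ell_short ^+ 2 by rewrite sqr_ge0.
apply: (@le_trans _ _ (ell_short ^+ 2 * (1 - dot w h ^+ 2) +
    ell_long ^+ 2 * (dot w h + (N + 1)^-1) ^+ 2)).
  by rewrite lerD2r ler_wpM2l// lerB.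
rewrite ell_short_sqr /ell_long; move: (dot w h) t0 t1 => t t0 t1.
rewrite -subr_ge0; move: (N) N_gt0 => M M_gt0.
have -> : 1 - ((1 - M^-1 ^+ 2) * (1 - t ^+ 2) +
      ((M + 1) / M) ^+ 2 * (t + (M + 1)^-1) ^+ 2) = (2 * (M + 1) / M ^+ 2) * (- t * (1 + t)).
  field; rewrite (gt_eqF M_gt0) gt_eqF//; lra.
rewrite mulr_ge0//; last by rewrite mulr_ge0; lra.
by rewrite divr_ge0 ?sqr_ge0//; lra.
Qed.

(** The volume is divided by ell_long * ell_short ^ (n - 1); by Bernoulli's
    inequality the square of that is at least 1 + 1 / (n + 1). *)
Lemma ell_cut_det g s : (0 < n)%N -> g != 0 -> s.2 \in unitmx ->
  (1 + N^-1) * \det s.2 ^+ 2 <= \det (ell_cut g s).2 ^+ 2.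
Proof.
case: s => c B n0 /= g0 Bu.
have := ell_dir_unit g0 Bu; set h := ell_dir g B => hh.
rewrite det_mulmx exprMn mulrC ler_wpM2l ?sqr_ge0//.
have N2 : 2 <= N by rewrite /N ler_nat.
have i2 : N^-1 <= 2^-1 by rewrite lef_pV2 ?posrE.
have i1 : N^-1 < 1 by rewrite (le_lt_trans i2)// invf_lt1 ?ltr1n.
have i0 : 0 < N^-1 by rewrite invr_gt0.
have s0 : ell_short ^+ 2 != 0.
  by rewrite ell_short_sqr gt_eqF// subr_gt0 expr_lt1 ?(ltW i0).
have b0 : ell_short != 0 by move: s0; rewrite sqrf_eq0.
have -> : \det (ell_short%:M + (ell_long - ell_short) *: (h^T *m h)) =
    ell_short ^+ n.-1 * ell_long.
  apply: (mulIf b0); rewrite det_add_rank1// hh mulr1 addrCA subrr addr0.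
  by rewrite -[in LHS](prednK n0) exprSr mulrAC.
rewrite exprMn -exprM mulnC exprM ell_short_sqr.
have le1 : 1 - n.-1%:R * N^-1 ^+ 2 <= (1 - N^-1 ^+ 2) ^+ n.-1.
  rewrite -mulrN; apply: bernoulli_ineq.
  by rewrite lerN2 expr_le1 ?(ltW i0)// ltW.
have le2 : (n.-1%:R + 1) * N^-1 ^+ 2 <= N^-1.
  rewrite -[leRHS]mul1r expr2 mulrA ler_pM2r//.
  by rewrite ler_pdivrMr// mul1r natr1 prednK// /N ler_nat.
have -> : ell_long = 1 + N^-1.
  by rewrite /ell_long mulrDl mulfV ?gt_eqF// mul1r.
apply: (@le_trans _ _ ((1 - N^-1 + N^-1 ^+ 2) * (1 + N^-1) ^+ 2)).
  have -> : (1 - N^-1 + N^-1 ^+ 2) * (1 + N^-1) ^+ 2 =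
    1 + N^-1 + N^-1 ^+ 3 * (1 + N^-1) by ring.
  by rewrite lerDl mulr_ge0 ?exprn_ge0 ?addr_ge0// ltW.
apply: ler_wpM2r; first exact: sqr_ge0.
apply: le_trans le1; rewrite -addrA lerD2l lerNr opprD opprK.
by rewrite lerBrDr -[X in _ + X]mul1r -mulrDl.
Qed.
End EllipsoidStep.

(** An ellipsoid is symmetric about its centre, so if it contains the points
    z +- eps e_i then every row of B has length at most 1 / eps; Hadamard's
    inequality does the rest. *)
Lemma ell_det_le (R : realType) n (s : 'rV[R]_n * 'M[R]_n) z eps : 0 < eps ->
  (forall i (b : bool), ellipsoid s (z + ((-1) ^+ b * eps) *: delta_mx 0 i)) ->
  \det s.2 ^+ 2 <= eps ^- 2 ^+ n.
Proof.
case: s => c B /= e0 sz; apply: le_trans (hadamard B) _.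
rewrite -[in leRHS](card_ord n) -prodr_const; apply: ler_prod => i _.
rewrite dot_ge0 /=.
have sE b : (z + ((-1) ^+ b * eps) *: delta_mx 0 i - c) *m B =
    (z - c) *m B + ((-1) ^+ b * eps) *: row i B.
  by rewrite addrAC mulmxDl -scalemxAl -rowE.
have := sz i false; have := sz i true; rewrite /ellipsoid /= !sE !dot_lin.
have := dot_ge0 ((z - c) *m B).
rewrite [dot (row i B) (_ *m _)]dotC expr1 expr0.
set p := dot _ (_ *m _); set q := dot _ (row i B); set v := dot (row i B) _.
move=> p0 h1 h2; rewrite -(@ler_pM2l _ (eps ^+ 2)) ?exprn_gt0//.
rewrite mulfV ?gt_eqF ?exprn_gt0//; nra.
Qed.

(** * The hyperboloid and its Busemann functions *)

Section Minkowski.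
Context {R : realType} {n : nat}.
Implicit Types (x y w u v : 'rV[R]_n.+1) (c p : hspace R n) (z : 'rV[R]_n).

Definition tail x : 'rV[R]_n := \row_i x 0 (lift ord0 i).
Definition hcons (t : R) z : 'rV[R]_n.+1 := \row_i oapp (z 0) t (unlift ord0 i).

Lemma hcons0 t z : hcons t z 0 ord0 = t.
Proof. by rewrite mxE unlift_none. Qed.

Lemma tail_hcons t z : tail (hcons t z) = z.
Proof. by apply/rowP => i; rewrite !mxE liftK. Qed.

Lemma hcons_tail x : hcons (x 0 ord0) (tail x) = x.
Proof.
by apply/rowP => i; rewrite !mxE; case: unliftP => [j|] -> //=; rewrite mxE.
Qed.

Lemma minkE x y : mink x y = - (x 0 ord0 * y 0 ord0) + dot (tail x) (tail y).
Proof. by rewrite /mink dotE; congr (_ + _); apply: eq_bigr => i _; rewrite !mxE. Qed.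

Lemma minkC x y : mink x y = mink y x.
Proof. by rewrite !minkE mulrC dotC. Qed.

Lemma minkZl k x y : mink (k *: x) y = k * mink x y.
Proof.
rewrite !minkE mxE mulrDr mulrN mulrA; congr (_ + _).
by rewrite -dotZl; congr dot; apply/rowP => i; rewrite !mxE.
Qed.

Lemma minkDl x x' y : mink (x + x') y = mink x y + mink x' y.
Proof.
rewrite !minkE mxE mulrDl opprD addrACA -dotDl; congr (_ + dot _ _).
by apply/rowP => i; rewrite !mxE.
Qed.

Lemma minkNl x y : mink (- x) y = - mink x y.
Proof. by rewrite -scaleN1r minkZl mulN1r. Qed.

Lemma minkZr k x y : mink x (k *: y) = k * mink x y.
Proof. by rewrite minkC minkZl minkC. Qed.

Lemma minkDr x y y' : mink x (y + y') = mink x y + mink x y'.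
Proof. by rewrite minkC minkDl !(minkC x). Qed.

Lemma minkNr x y : mink x (- y) = - mink x y.
Proof. by rewrite minkC minkNl minkC. Qed.

Definition mink_lin := (minkDl, minkDr, minkNl, minkNr, minkZl, minkZr).

Lemma hsq c : mink c c = -1.
Proof. by case: c => x /= /andP[/eqP]. Qed.

Lemma hpos c : 0 < c 0 ord0.
Proof. by case: c => x /= /andP[]. Qed.

Lemma hcoord_sqr c : c 0 ord0 ^+ 2 = 1 + dot (tail c) (tail c).
Proof. have := hsq c; rewrite minkE -expr2; lra. Qed.

(** Cauchy-Schwarz for the space parts: a timelike or null vector has a space part
    no longer than its time part, strictly so on the hyperboloid. *)
Lemma dot_tail_lt c y : mink y y <= 0 -> y != 0 ->
  dot (tail c) (tail y) < c 0 ord0 * `|y 0 ord0|.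
Proof.
rewrite minkE -expr2 addrC subr_le0 => yy y0.
have y00 : 0 < `|y 0 ord0|.
  rewrite normr_gt0; apply: contraNneq y0 => y00.
  move: yy; rewrite y00 expr0n /= => yy.
  have /eqP : dot (tail y) (tail y) == 0 by rewrite eq_le yy dot_ge0.
  move/eqP; rewrite dot_eq0 => /eqP t0.
  rewrite -(hcons_tail y) y00 t0; apply/eqP/rowP => i.
  by rewrite !mxE; case: unlift => //= j; rewrite mxE.
apply: le_lt_trans (ler_norm _) _.
rewrite -(@ltr_pXn2r _ 2)// ?nnegrE ?mulr_ge0 ?(ltW (hpos c))//.
rewrite real_normK ?num_real// exprMn real_normK ?num_real//.
apply: le_lt_trans (cauchy_schwarz _ _) _; rewrite hcoord_sqr.
have := dot_ge0 (tail c); have : 0 < y 0 ord0 ^+ 2.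
  by rewrite -real_normK ?num_real// exprn_gt0.
by move: yy; nra.
Qed.

(** The reversed Cauchy-Schwarz inequality of the Lorentz form. *)
Lemma mink_ge1 c p : 1 <= - mink c p.
Proof.
rewrite minkE opprD opprK.
have c0 := hpos c; have p0 := hpos p.
have c2 := hcoord_sqr c; have p2 := hcoord_sqr p.
have c1 : 1 <= c 0 ord0.
  by rewrite -(@expr_ge1 _ 2) ?(ltW c0)// c2 lerDl dot_ge0.
have p1 : 1 <= p 0 ord0.
  by rewrite -(@expr_ge1 _ 2) ?(ltW p0)// p2 lerDl dot_ge0.
have cp1 : 0 <= c 0 ord0 * p 0 ord0 - 1 by nra.
suff : dot (tail c) (tail p) <= c 0 ord0 * p 0 ord0 - 1 by lra.
apply: le_trans (ler_norm _) _; rewrite -(@ler_pXn2r _ 2)// ?nnegrE//.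
rewrite real_normK ?num_real//; apply: le_trans (cauchy_schwarz _ _) _.
have -> : dot (tail c) (tail c) = c 0 ord0 ^+ 2 - 1 by rewrite c2 addrC addKr.
have -> : dot (tail p) (tail p) = p 0 ord0 ^+ 2 - 1 by rewrite p2 addrC addKr.
by have := sqr_ge0 (c 0 ord0 - p 0 ord0); lra.
Qed.

(** Two timelike vectors with negative product lie in the same half of the cone. *)
Lemma hspaceP c y : mink y y = -1 -> mink c y < 0 ->
  (mink y y == -1) && (0 < y 0 ord0).
Proof.
move=> yy cy; rewrite yy eqxx /= ltNge; apply/negP => y0.
have yN0 : y != 0.
  apply/eqP => yE; move: cy; rewrite yE -(scale0r 0) minkZr mul0r ltxx //.
have := @dot_tail_lt c (- y); rewrite mink_lin minkNr opprK yy oppr_eq0 => /(_ _ yN0).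
have -> : tail (- y) = - tail y by apply/rowP => i; rewrite !mxE.
rewrite mxE normrN ler0_norm// dotNr => /(_ (lerN10 _)).
by move: cy; rewrite minkE; lra.
Qed.

(** The point at signed distance ln q from y in direction u; the parameter
    q = exp (- t) turns both the limit t -> +oo and the optimal step of the ball
    phase into algebra. *)
Definition geodesic y u (q : R) : 'rV[R]_n.+1 :=
  ((q^-1 + q) / 2) *: y - ((q^-1 - q) / 2) *: u.

Lemma geodesicP c u q : 0 < q -> mink c u = 0 -> mink u u = 1 ->
  (mink (geodesic c u q) (geodesic c u q) == -1) && (0 < geodesic c u q 0 ord0).
Proof.
move=> q0 cu uu; apply: (@hspaceP c).
  by rewrite /geodesic !mink_lin (minkC u c) cu uu hsq; field; rewrite gt_eqF.
rewrite /geodesic !mink_lin hsq cu mulr0 oppr0 addr0 mulrN1 oppr_lt0.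
by rewrite divr_gt0// addr_gt0// invr_gt0.
Qed.

(** Otherwise - <x, p>, for x on the geodesic leaving c in direction - u, would drop
    below 1 as q -> 0, against [mink_ge1]. *)
Lemma horo_gt0 c u p : mink c u = 0 -> mink u u = 1 -> 0 < mink u p - mink c p.
Proof.
move=> cu uu; rewrite ltNge; apply/negP => a0.
set b := - mink c p - mink u p.
have q1 q : 0 < q -> 2 <= b * q.
  move=> q0; have := mink_ge1 (HSpace (geodesicP q0 cu uu)) p.
  rewrite /= /geodesic !mink_lin => h.
  have i0 : 0 < q^-1 by rewrite invr_gt0.
  have : q^-1 * (mink u p - mink c p) <= 0 by rewrite mulr_ge0_le0// ltW.
  by move: h; rewrite /b; lra.
have b1 : 0 < `|b| + 1 by rewrite ltr_wpDl.
have := q1 (`|b| + 1)^-1; rewrite invr_gt0 => /(_ b1).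
rewrite ler_pdivlMr//; have := ler_norm b; have := normr_ge0 b; lra.
Qed.

Lemma hexp_geodesic y u t : mink u u = 1 -> 0 < t ->
  hexp y (- t *: u) = geodesic y u (expR (- t)).
Proof.
move=> uu t0; have nt : hnorm (- t *: u) = t.
  by rewrite /hnorm !mink_lin uu mulr1 mulrNN -expr2 sqrtr_sqr gtr0_norm.
rewrite /hexp nt /geodesic /cosh /sinh expRN invrK scalerA -scaleNr; congr (_ + _ *: _).
by rewrite mulrN divfK ?gt_eqF.
Qed.

(** Multiplying the argument of the logarithm by q = exp (- t) absorbs the - t; what
    remains is a function of q that is continuous at 0. *)
Lemma busemannE c u p : mink c u = 0 -> mink u u = 1 ->
  busemann_unit c u p = ln (mink u p - mink c p).
Proof.
move=> cu uu; apply/cvg_lim => //.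
have a0 := horo_gt0 p cu uu; set a := mink u p - mink c p in a0 *.
set b := - mink c p - mink u p.
(* g q is q times - <x, p> at the point x of parameter q, and G q is q times the
   argument of ln in arcosh. *)
pose g (s : R) := a / 2 + s ^+ 2 * (b / 2).
pose G (s : R) := g s + Num.sqrt (g s * g s - s ^+ 2).
have g0 : g s @[s --> (0 : R)] --> a / 2.
  have -> : a / 2 = a / 2 + 0 ^+ 2 * (b / 2) by rewrite expr0n mul0r addr0.
  apply: cvgD; first exact: cvg_cst.
  by apply: cvgM; [apply: exprn_continuous | exact: cvg_cst].
have G0 : G s @[s --> (0 : R)] --> a.
  have -> : a = a / 2 + Num.sqrt (a / 2 * (a / 2) - 0 ^+ 2).
    by rewrite -expr2 expr0n subr0 sqrtr_sqr ger0_norm ?divr_ge0 ?(ltW a0)//; lra.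
  apply: cvgD => //; apply: continuous_cvg; first exact: sqrt_continuous.
  apply: cvgB; last exact: exprn_continuous.
  exact: cvgM.
have H : ln (G (expR (- t))) @[t --> +oo] --> ln a.
  apply: continuous_cvg; first exact: continuous_ln.
  apply: (cvg_comp (fun t : R => expR (- t)) G) G0; exact: cvgr_expR.
apply: cvg_trans H; apply: near_eq_cvg; near=> t.
have t0 : 0 < t by near: t; exact: nbhs_pinfty_gt.
have q0 := expR_gt0 (- t).
rewrite hexp_geodesic// /hdist /arcosh; set q := expR (- t) in q0 *.
have -> : t = - ln q by rewrite expRK opprK.
rewrite opprK.
have w1 := mink_ge1 (HSpace (geodesicP q0 cu uu)) p; rewrite /= in w1.
have wE : - mink (geodesic c u q) p * q = g q.
  by rewrite /geodesic !mink_lin /g /a /b; field; rewrite gt_eqF.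
set w := - mink _ _ in w1 wE *.
have w2 : 0 <= w ^+ 2 - 1 by rewrite subr_ge0 expr_ge1 // ltW// (lt_le_trans _ w1).
rewrite -lnM ?posrE//; last by rewrite ltr_pwDl ?sqrtr_ge0// (lt_le_trans _ w1).
congr ln; rewrite /G -wE mulrDl -expr2; congr (_ + _).
have -> : (w * q) ^+ 2 - q ^+ 2 = (w ^+ 2 - 1) * q ^+ 2 by ring.
by rewrite sqrtrM// sqrtr_sqr gtr0_norm.
Unshelve. all: by end_near.
Qed.

End Minkowski.

(** * Horoball cuts and the Klein chart *)

(** Here s bounds the hyperbolic sine of the distance; the constant 2 is not
    optimal but needs only 1 + x <= exp x. *)
Lemma arcosh_le2 (R : realType) (w s : R) : 0 <= s -> 1 <= w ->
  w ^+ 2 - 1 <= s ^+ 2 -> arcosh w <= 2 * s.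
Proof.
move=> s0 w1 ws; have w0 : 0 <= w by apply: le_trans w1.
have ws1 : w <= 1 + s.
  rewrite -(@ler_pXn2r _ 2)// ?nnegrE ?addr_ge0//; nra.
have r1 : Num.sqrt (w ^+ 2 - 1) <= s.
  by rewrite -[leRHS](ger0_norm s0) -sqrtr_sqr ler_wsqrtr.
rewrite /arcosh -[leRHS]expRK ler_ln ?posrE ?expR_gt0//.
  by apply: le_trans (expR_ge1Dx _); lra.
by rewrite ltr_pwDl ?sqrtr_ge0// (lt_le_trans _ w1).
Qed.

Lemma le_cosh_arcosh (R : realType) (w r : R) : 1 <= w -> arcosh w <= r -> w <= cosh r.
Proof.
move=> w1; have w0 : 0 < w by apply: lt_le_trans w1.
have e0 := expR_gt0 r.
rewrite /arcosh -[in X in X -> _](expRK r) ler_ln ?posrE//; last first.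
  by rewrite ltr_pwDl ?sqrtr_ge0.
move=> h; rewrite /cosh expRN ler_pdivlMr//.
have w2 : 0 <= w ^+ 2 - 1 by rewrite subr_ge0 expr_ge1 // ltW.
have s0 := sqrtr_ge0 (w ^+ 2 - 1).
have : w ^+ 2 - 1 <= (expR r - w) ^+ 2.
  rewrite -[leLHS]sqr_sqrtr// ler_pXn2r ?nnegrE ?sqrtr_ge0//; lra.
have : expR r * (expR r)^-1 = 1 by rewrite mulfV ?gt_eqF.
move: (expR r)^-1 => i ei h2.
rewrite -(ler_pM2l e0); lra.
Qed.

Section Cuts.
Context {R : realType} {n : nat}.
Implicit Types (c p x y : hspace R n) (v : 'rV[R]_n.+1) (z : 'rV[R]_n) (f : hspace R n -> R).

Definition unit_dir v : 'rV[R]_n.+1 := (hnorm v)^-1 *: v.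

Lemma unit_dirP c v : tangent c v -> 0 < hnorm v ->
  mink c (unit_dir v) = 0 /\ mink (unit_dir v) (unit_dir v) = 1.
Proof.
rewrite /tangent /unit_dir => cv v0; rewrite !minkZl !minkZr cv mulr0; split=> //.
have vv : mink v v = hnorm v ^+ 2 by rewrite sqr_sqrtr// ltW// -sqrtr_gt0.
by rewrite vv expr2 mulKf ?mulVf ?gt_eqF.
Qed.

(** By [busemannE], the sublevel set at 0 of the Busemann function of v at c. *)
Definition horoball c v : set (hspace R n) :=
  [set x | mink (unit_dir v) x - mink c x <= 1].

Lemma subgradient_horoball f c v x : hsubgradient f c v -> 0 < hnorm v ->
  f x <= f c -> horoball c v x.
Proof.
move=> [cv sub] v0 fx; have [cu uu] := unit_dirP cv v0.
have := sub x; rewrite /busemann -/(unit_dir v) busemannE// => h.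
have : hnorm v * ln (mink (unit_dir v) x - mink c x) <= 0.
  by apply: le_trans h _; rewrite subr_le0.
rewrite pmulr_rle0// -ln1 ler_ln ?posrE// /horoball //=.
exact: horo_gt0.
Qed.

Lemma subgradient_min f c v x : hsubgradient f c v -> hnorm v = 0 -> f c <= f x.
Proof. by move=> [_ /(_ x)] + v0; rewrite /busemann v0 mul0r subr_ge0. Qed.

Lemma horoball_halfspace c v x : 0 < hnorm v -> horoball c v x -> mink v x <= 0.
Proof.
rewrite /horoball /= /unit_dir minkZl => v0 h.
have := mink_ge1 c x => cx.
have : (hnorm v)^-1 * mink v x <= 0 by lra.
by rewrite pmulr_rle0// invr_gt0.
Qed.

(** K is the hyperbolic cosine of a radius; see [ball_cut]. *)
Definition shrink (K : R) : R := Num.sqrt (2 * K - 1).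

Definition ball_centre c v (K : R) : hspace R n :=
  insubd c (geodesic c (unit_dir v) (shrink K)^-1).

Lemma shrink_ge1 K : 1 <= K -> 1 <= shrink K.
Proof. by move=> K1; rewrite -[leLHS]sqrtr1 ler_wsqrtr//; lra. Qed.

Lemma shrink_sqr K : 1 <= K -> shrink K ^+ 2 = 2 * K - 1.
Proof. by move=> K1; rewrite sqr_sqrtr//; lra. Qed.

(** At the point with parameter q, the bound is q (K - 1/2) + 1 / (2 q); it is
    smallest for q = 1 / sqrt (2 K - 1). *)
Lemma ball_cut c v K x : tangent c v -> 0 < hnorm v -> 1 <= K ->
  - mink c x <= K -> horoball c v x -> - mink (ball_centre c v K) x <= shrink K.
Proof.
move=> cv v0 K1 cK; rewrite /horoball /=; have [cu uu] := unit_dirP cv v0.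
have s1 := shrink_ge1 K1; have s2 := shrink_sqr K1.
have s0 : 0 < shrink K by apply: lt_le_trans s1.
have q0 : 0 < (shrink K)^-1 by rewrite invr_gt0.
have q1 : (shrink K)^-1 <= 1 by rewrite invf_le1.
have vE : hcoord (ball_centre c v K) = geodesic c (unit_dir v) (shrink K)^-1.
  by rewrite -[hcoord _]/(val _) insubdK//; exact: geodesicP.
rewrite vE /geodesic invrK; move: (unit_dir v) {cu uu vE} => u; rewrite !mink_lin.
have sq : shrink K * (shrink K)^-1 = 1 by rewrite mulfV ?gt_eqF.
move: (shrink K) (shrink K)^-1 s1 s2 s0 q0 q1 sq => s q s1 s2 s0 q0 q1 sq h.
have : 0 <= (s - q) * (1 + mink c x - mink u x).
  by apply: mulr_ge0; lra.
have : q * - mink c x <= q * K by rewrite ler_wpM2l// ltW.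
have : q * (2 * K - 1) = s by rewrite -s2 expr2 mulrA [q * s]mulrC sq mul1r.
lra.
Qed.

(** [flip c] is the reflection in the bisector of c and the base point
    e_0 = [hcons 1 0].  When they coincide the axis is 0 and, since 0^-1 = 0, it
    is the identity. *)
Definition flip_axis c : 'rV[R]_n.+1 := hcoord c - hcons 1 0.

Definition flip c v : 'rV[R]_n.+1 :=
  v - (2 * mink v (flip_axis c) / mink (flip_axis c) (flip_axis c)) *: flip_axis c.

Lemma flip_mink c v v' : mink (flip c v) (flip c v') = mink v v'.
Proof.
rewrite /flip; move: (flip_axis c) => w.
have [w0|w0] := eqVneq (mink w w) 0.
  by rewrite w0 invr0 !mulr0 !scale0r !subr0.
by rewrite !mink_lin (minkC w v'); field.
Qed.

Lemma flipK c v : flip c (flip c v) = v.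
Proof.
rewrite /flip; move: (flip_axis c) => w.
have [w0|w0] := eqVneq (mink w w) 0.
  by rewrite w0 invr0 !mulr0 !scale0r !subr0.
rewrite -addrA -opprD -scalerDl.
have -> : 2 * mink v w / mink w w +
    2 * mink (v - (2 * mink v w / mink w w) *: w) w / mink w w = 0.
  by rewrite !mink_lin; field.
by rewrite scale0r subr0.
Qed.

Lemma mink_flip c v v' : mink (flip c v) v' = mink v (flip c v').
Proof. by rewrite -(flip_mink c) flipK. Qed.

Lemma flipZ c k v : flip c (k *: v) = k *: flip c v.
Proof.
rewrite /flip; move: (flip_axis c) => w.
by rewrite minkZl scalerBr scalerA !mulrA [2 * k]mulrC.
Qed.

Lemma flip_base c : flip c (hcons 1 0) = c.
Proof.
rewrite /flip; set w := flip_axis c.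
have e00 : mink (hcons 1 0 : 'rV[R]_n.+1) (hcons 1 0) = -1.
  by rewrite minkE hcons0 tail_hcons dot0l mulr1 addr0.
have ew : mink (hcons 1 0) w = - (mink w w / 2).
  by rewrite /w /flip_axis !mink_lin (minkC (hcons 1 0) c) e00 hsq; field.
have [w0|w0] := eqVneq (mink w w) 0; last first.
  rewrite ew; have -> : 2 * - (mink w w / 2) / mink w w = -1 by field.
  by rewrite scaleN1r opprK /w /flip_axis addrC subrK.
rewrite w0 invr0 mulr0 scale0r subr0.
have c01 : c 0 ord0 = 1.
  move: w0; rewrite /w /flip_axis !mink_lin (minkC (hcons 1 0) c) e00 hsq.
  rewrite minkE hcons0 tail_hcons dotC dot0l; lra.
have : dot (tail c) (tail c) == 0.
  by have := hcoord_sqr c; rewrite c01 expr1n => /eqP; rewrite addrC -subr_eq subrr eq_sym.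
by rewrite dot_eq0 => /eqP t0; rewrite -[RHS]hcons_tail c01 t0.
Qed.

(** The Klein chart centred at c, read from Euclidean space to the hyperboloid;
    outside the open unit ball it takes the default value c. *)
Definition klein c z : hspace R n :=
  insubd c ((Num.sqrt (1 - dot z z))^-1 *: flip c (hcons 1 z)).

Lemma mink_hcons1 z z' : mink (hcons 1 z) (hcons 1 z') = - (1 - dot z z').
Proof. by rewrite minkE !hcons0 !tail_hcons mulr1 opprB addrC. Qed.

Lemma kleinE c z : dot z z < 1 ->
  hcoord (klein c z) = (Num.sqrt (1 - dot z z))^-1 *: flip c (hcons 1 z).
Proof.
move=> z1; rewrite -[hcoord _]/(val _) insubdK//.
have s0 : 0 < Num.sqrt (1 - dot z z) by rewrite sqrtr_gt0 subr_gt0.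
apply: (@hspaceP _ _ c).
  rewrite minkZl minkZr flip_mink mink_hcons1 mulrA -invfM -expr2 sqr_sqrtr ?subr_ge0 ?ltW//.
  by rewrite mulrN mulVf// gt_eqF// subr_gt0.
rewrite minkZr -(mink_flip c) -[X in mink (flip c X)]flip_base flipK mink_hcons1 dot0l subr0.
by rewrite mulrN1 oppr_lt0 invr_gt0.
Qed.

Lemma klein_mink c z z' : dot z z < 1 -> dot z' z' < 1 ->
  - mink (klein c z) (klein c z') =
  (1 - dot z z') / (Num.sqrt (1 - dot z z) * Num.sqrt (1 - dot z' z')).
Proof.
move=> z1 z1'; rewrite !kleinE// minkZl minkZr flip_mink mink_hcons1.
by rewrite !mulrN opprK invfM; ring.
Qed.

(** Since (1 - z.z')^2 - (1 - |z|^2)(1 - |z'|^2) <= |z - z'|^2 by Cauchy-Schwarz,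
    the chart distorts distances by a bounded factor on the ball of radius 1/2. *)
Lemma klein_dist c z z' : dot z z <= 1 / 4 -> dot z' z' <= 1 / 4 ->
  hdist (klein c z) (klein c z') <= 4 * Num.sqrt (dot (z - z') (z - z')).
Proof.
move=> z1 z1'.
have z2 : dot z z < 1 by lra.
have z2' : dot z' z' < 1 by lra.
set s := Num.sqrt (dot _ _); have s0 : 0 <= s by rewrite sqrtr_ge0.
have -> : 4 * s = 2 * (2 * s) by rewrite mulrA -natrM.
apply: arcosh_le2; rewrite ?mulr_ge0// ?mink_ge1//.
rewrite klein_mink// expr_div_n exprMn !sqr_sqrtr ?subr_ge0 ?(ltW z2) ?(ltW z2')//.
have d0 : 0 < (1 - dot z z) * (1 - dot z' z') by apply: mulr_gt0; lra.
have d1 : 1 / 4 <= (1 - dot z z) * (1 - dot z' z') by nra.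
rewrite -(ler_pM2r d0) mulrBl divfK ?gt_eqF// mul1r exprMn sqr_sqrtr ?dot_ge0//.
apply: (@le_trans _ _ (dot (z - z') (z - z'))).
  have := cauchy_schwarz z z'; rewrite !dot_lin (dotC z' z); lra.
have := dot_ge0 (z - z'); nra.
Qed.

Lemma klein_surj c x : exists2 z, x = klein c z & dot z z = 1 - (mink c x)^-2.
Proof.
pose v := flip c x; pose X := - mink c x.
have X1 : 1 <= X := mink_ge1 c x.
have X0 : 0 < X by apply: lt_le_trans X1.
have v0 : v 0 ord0 = X.
  have : mink (hcons 1 0) v = - v 0 ord0.
    by rewrite minkE hcons0 tail_hcons dot0l mul1r addr0.
  by rewrite /v -mink_flip flip_base /X => ->; rewrite opprK.
pose z := X^-1 *: tail v.
have vE : v = X *: hcons 1 z.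
  rewrite -[LHS]hcons_tail v0; apply/rowP => i; rewrite !mxE.
  case: (unlift ord0 i) => [j|] /=; last by rewrite mulr1.
  by rewrite !mxE mulrA mulfV ?gt_eqF// mul1r.
have zz : dot z z = 1 - X^-2.
  have : mink v v = -1 by rewrite flip_mink hsq.
  rewrite vE minkZl minkZr mink_hcons1 => h.
  have : X ^+ 2 * (1 - dot z z) = 1 by lra.
  by move/(canRL (mulKf _)); rewrite sqrf_eq0 gt_eqF// mulr1 => /(_ isT); lra.
have i0 : 0 < X^-2 by rewrite invr_gt0 exprn_gt0.
exists z; last by rewrite zz /X sqrrN.
apply/val_inj; rewrite /= kleinE; last by rewrite zz; lra.
rewrite zz opprB addrCA subrr addr0 -exprVn sqrtr_sqr gtr0_norm ?invr_gt0// invrK.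
by rewrite -flipZ -vE flipK.
Qed.

End Cuts.

(** * Cutting methods and the ball phase *)

Section Cutting.
Context {R : realType} {n : nat} {St : Type}.
Variables (pt : St -> hspace R n) (upd : St -> 'rV[R]_n.+1 -> St).
Implicit Types (s : St) (b : hspace R n * R) (f : hspace R n -> R).

(** N steps of a localization method: query the point of the current state and
    update the state with the subgradient, remembering the best query with its
    value, then hand over to k.  The continuation lets the second phase start from
    the state reached by the first. *)
Fixpoint cutting (N : nat) s b
    (k : St -> hspace R n * R -> algorithm R n) : algorithm R n :=
  if N is N'.+1 then
    Query (pt s) (fun fx v =>
      cutting N' (upd s v) (if fx <= b.2 then (pt s, fx) else b) k)
  else k s b.

(** An update may discard only points outside the horoball of the query.  The map
    emb lets a region live in a chart of the space; Inv i is what is known of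
    the state after i steps. *)
Definition cut_sound (X : Type) (emb : X -> hspace R n) (Inv : nat -> St -> Prop)
    (Loc : St -> set X) : Prop :=
  forall i s v, Inv i s -> tangent (pt s) v -> 0 < hnorm v ->
  Inv i.+1 (upd s v) /\
  forall x, Loc s x -> horoball (pt s) v (emb x) -> Loc (upd s v) x.

(** A point that beats the final best value beats every query, so it lies in all the
    horoballs and survives in the region.  A zero subgradient gives no
    horoball, but then the query is a global minimum; hence the alternative. *)
Lemma cutting_run f (X : Type) (emb : X -> hspace R n) Inv (Loc : St -> set X) :
  cut_sound emb Inv Loc -> forall N i s b k m z,
  b.2 = f b.1 ->
  (forall x, b.2 <= f x) \/ Inv i s ->
  alg_run f (cutting N s b k) m z ->
  exists s' b' m', [/\ m = (N + m')%N, alg_run f (k s' b') m' z,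
    b'.2 = f b'.1, b'.2 <= b.2 &
    (forall x, b'.2 <= f x) \/
    (Inv (i + N)%N s' /\
     forall x, Loc s x -> f (emb x) < b'.2 -> Loc s' x)].
Proof.
move=> snd; elim=> [|N IH] i s b k m z bf inv /= run.
  by exists s, b, m; split=> //; case: inv; [left | right; rewrite addn0].
inversion run as [|x next v m' z' sub run' ex em ez]; subst.
set b1 := if f (pt s) <= b.2 then (pt s, f (pt s)) else b in run'.
have b1f : b1.2 = f b1.1 by rewrite /b1; case: ifP.
have b1s : b1.2 <= f (pt s) by rewrite /b1; case: (leP (f (pt s)) b.2) => //= /ltW.
have b1b : b1.2 <= b.2 by rewrite /b1; case: (leP (f (pt s)) b.2).
have min1 : (forall x, b.2 <= f x) \/ hnorm v = 0 -> forall x, b1.2 <= f x.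
  move=> [h|v0] x; first exact: le_trans b1b (h x).
  exact: le_trans b1s (subgradient_min x sub v0).
have [v0|v0] := eqVneq (hnorm v) 0.
  have [s' [b' [m1 [-> r1 bf' bb _]]]] :=
    IH i _ _ _ _ _ b1f (or_introl (min1 (or_intror v0))) run'.
  exists s', b', m1; split=> //; first exact: le_trans bb b1b.
  by left=> x; apply: le_trans bb (min1 (or_intror v0) x).
have v1 : 0 < hnorm v by rewrite lt_neqAle eq_sym v0 sqrtr_ge0.
case: inv => inv.
  have [s' [b' [m1 [-> r1 bf' bb _]]]] :=
    IH i _ _ _ _ _ b1f (or_introl (min1 (or_introl inv))) run'.
  exists s', b', m1; split=> //; first exact: le_trans bb b1b.
  by left=> x; apply: le_trans bb (min1 (or_introl inv) x).
have [inv' loc] := snd _ _ _ inv sub.1 v1.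
have [s' [b' [m1 [-> r1 bf' bb h]]]] := IH i.+1 _ _ _ _ _ b1f (or_intror inv') run'.
exists s', b', m1; split=> //; first exact: le_trans bb b1b.
case: h => [h|[i' h]]; [by left | right].
split=> [|x lx fx]; first by rewrite addnS -addSn.
apply: h => //; apply: loc => //; apply: subgradient_horoball sub v1 _.
by rewrite ltW// (lt_le_trans fx)// (le_trans bb).
Qed.
End Cutting.

Section BallPhase.
Context {R : realType} {n : nat}.

Definition ball_point (s : hspace R n * R) : hspace R n := s.1.
Definition ball_update (s : hspace R n * R) (v : 'rV[R]_n.+1) : hspace R n * R :=
  (ball_centre s.1 v s.2, shrink s.2).
Definition in_ball (s : hspace R n * R) : set (hspace R n) := [set x | - mink s.1 x <= s.2].

Lemma ball_sound (K : R) : 1 <= K ->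
  cut_sound ball_point ball_update id (fun i s => s.2 = iter i shrink K) in_ball.
Proof.
move=> K1 i [c K'] v /= sE cv v0; split=> [|x]; first by rewrite sE.
apply: ball_cut => //; rewrite sE; elim: i {sE} => //= i; exact: shrink_ge1.
Qed.
End BallPhase.

Section Radii.
Context {R : realType}.
Implicit Types K r : R.

Lemma shrink_le K : 1 <= K -> shrink K <= K.
Proof.
move=> K1; have K0 : 0 <= K by apply: le_trans K1.
rewrite -(@ler_pXn2r _ 2)// ?nnegrE ?sqrtr_ge0// shrink_sqr//.
by have := sqr_ge0 (K - 1); lra.
Qed.

Lemma iter_shrink_ge1 i K : 1 <= K -> 1 <= iter i shrink K.
Proof. by move=> K1; elim: i => //= i; exact: shrink_ge1. Qed.

Lemma iter_shrink_le i K : 1 <= K -> iter i shrink K <= K.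
Proof.
by move=> K1; elim: i => //= i; apply: le_trans; apply/shrink_le/iter_shrink_ge1.
Qed.

(** Because shrink K <= sqrt (2 K), each step halves an upper bound on ln (K / 2). *)
Lemma iter_shrink_exp i K r : 1 <= K -> K <= 2 * expR (2 ^+ i * r) ->
  iter i shrink K <= 2 * expR r.
Proof.
elim: i K => [|i IH] K K1 Kr; first by move: Kr; rewrite expr0 mul1r.
rewrite iterSr; apply: IH; first exact: shrink_ge1.
have e0 := expR_gt0 (2 ^+ i * r).
rewrite -(@ler_pXn2r _ 2)// ?nnegrE ?sqrtr_ge0 ?mulr_ge0 ?(ltW e0)// shrink_sqr//.
apply: (@le_trans _ _ (2 * K)); first lra.
have : expR (2 ^+ i.+1 * r) = expR (2 ^+ i * r) ^+ 2.
  by rewrite exprS -mulrA -expRM_natl.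
move: Kr => /[swap] ->; lra.
Qed.

(** If J' = shrink J then J - J' = (J' - 1)^2 / 2, so J drops by at least
    1 / 8192 as long as J' > 1 + 1/64. *)
Lemma iter_shrink_lin i K : 1 <= K ->
  iter i shrink K <= 65 / 64 \/ iter i shrink K <= K - i%:R / 8192.
Proof.
move=> K1; elim: i => [|i [IH|IH]] /=; first by right; rewrite mul0r subr0.
  by left; apply: le_trans (shrink_le _) IH; exact: iter_shrink_ge1.
have J1 := iter_shrink_ge1 i K1; set J := iter i shrink K in IH J1 *.
have s2 := shrink_sqr J1; have [s1|s1] := leP (shrink J) (65 / 64); first by left.
right; rewrite -natr1; nra.
Qed.

Lemma pow2_between (x : R) : 1 <= x -> exists j, x <= 2 ^+ j <= 2 * x.
Proof.
move=> x1; have ex : exists j, x <= 2 ^+ j.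
  exists (Num.bound x); have x0 : 0 <= x by apply: le_trans x1.
  apply: le_trans (ltW (archi_boundP x0)) _.
  by rewrite -natrX ler_nat ltnW// ltn_expl.
case: (ex_minnP ex) => -[|j] xj min; first by exists 0%N; rewrite xj expr0; lra.
exists j.+1; rewrite xj exprS ler_pM2l//= leNgt; apply/negP => xlt.
by have := min j (ltW xlt); rewrite ltnn.
Qed.

End Radii.

Section CoshBounds.
Context {R : realType}.
Implicit Types K r : R.

Lemma cosh_ge1 r : 1 <= cosh r.
Proof.
rewrite /cosh ler_pdivlMr// mul1r; have e0 := expR_gt0 (- r).
have : 0 <= expR (- r) * (expR r - 1) ^+ 2 by rewrite mulr_ge0 ?sqr_ge0// ltW.
have -> : expR (- r) * (expR r - 1) ^+ 2 =
    (expR r * expR (- r)) * (expR r - 2) + expR (- r) by ring.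
by rewrite expRxMexpNx_1; lra.
Qed.

Lemma cosh_le_exp r : 0 <= r -> cosh r <= 2 * expR r.
Proof.
move=> r0; have : expR (- r) <= expR r by rewrite ler_expR; lra.
by rewrite /cosh; have := expR_gt0 r; lra.
Qed.

Lemma cosh_small r : 0 <= r <= 1 / 2 -> cosh r ^+ 2 - 1 <= (2 * r) ^+ 2.
Proof.
move=> /andP[r0 r1].
have -> : cosh r ^+ 2 - 1 = ((expR r - expR (- r)) / 2) ^+ 2.
  have -> : cosh r ^+ 2 - 1 =
      ((expR r - expR (- r)) / 2) ^+ 2 + (expR r * expR (- r) - 1).
    by rewrite /cosh; field.
  by rewrite expRxMexpNx_1 subrr addr0.
have h1 := expR_ge1Dx (- r); have h2 := expRxMexpNx_1 r.
have e0 := expR_gt0 r.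
have h3 : expR (- r) <= expR r by rewrite ler_expR; lra.
have h4 : expR r <= 1 + 2 * r.
  have r2 : 0 < 1 - r by lra.
  have h6 : 0 <= r * (1 - 2 * r) by rewrite mulr_ge0//; lra.
  have h5 : expR r * (1 - r) <= expR r * expR (- r) by rewrite ler_pM2l.
  by move: h5; rewrite h2 => h5; rewrite -(ler_pM2r r2); lra.
by rewrite ler_pXn2r// ?nnegrE; lra.
Qed.

Lemma shrink_steps : exists N0, forall r j, 0 <= r -> r <= 2 ^+ j ->
  iter (j + N0) shrink (cosh r) <= 65 / 64.
Proof.
(* After j steps K <= E; then K drops by 1 / 8192 per step until it is at most
   65/64, and it cannot fall below 1. *)
pose E : R := 2 * expR 1; exists (Num.bound (8192 * E)) => r j r0 rj.
have K1 := cosh_ge1 r; rewrite addnC iterD.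
have KE : iter j shrink (cosh r) <= E.
  apply: iter_shrink_exp => //; apply: le_trans (cosh_le_exp r0) _.
  by rewrite ler_pM2l// ler_expR mulr1.
have E0 : 0 <= 8192 * E.
  by apply: mulr_ge0; [exact: ler0n | apply: mulr_ge0; [exact: ler0n | exact: expR_ge0]].
have := archi_boundP E0; set N := Num.bound _ => EN.
have := iter_shrink_ge1 N (iter_shrink_ge1 j K1).
have [//|] := iter_shrink_lin N (iter_shrink_ge1 j K1).
move: (iter N _ _) => J' h J1; move: KE h EN J1; clearbody E.
by move: (iter j _ _) (N%:R) => J B; lra.
Qed.

End CoshBounds.

(** * The ellipsoid phase *)

Section EllipsoidPhase.
Context {R : realType} {n : nat}.
Implicit Types (c : hspace R n) (z : 'rV[R]_n) (s : 'rV[R]_n * 'M[R]_n).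
Variables (c : hspace R n) (rad : R).
Hypotheses (n_gt0 : (0 < n)%N) (rad_gt0 : 0 < rad) (rad_lt1 : rad < 1).

Definition ell_point s : hspace R n := klein c s.1.
(** If the centre has left the ball of radius rad, that ball itself provides the
    cut and the subgradient is ignored; the query only keeps the steps uniform. *)
Definition ell_update s (v : 'rV[R]_n.+1) : 'rV[R]_n * 'M[R]_n :=
  ell_cut (if dot s.1 s.1 <= rad ^+ 2 then tail (flip c v) else s.1) s.
Definition in_ell s : set 'rV[R]_n := [set z | dot z z <= rad ^+ 2 /\ ellipsoid s z].
Definition ell_start : 'rV[R]_n * 'M[R]_n := (0, (rad^-1)%:M).
(** The square of det B is the inverse square of the volume, up to a constant; the
    initial ball has radius rad. *)
Definition ell_growth (i : nat) s : Prop :=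
  (1 + n.+1%:R^-1) ^+ i * (rad ^- 2) ^+ n <= \det s.2 ^+ 2.

Lemma ell_start_growth : ell_growth 0 ell_start.
Proof.
by rewrite /ell_growth /= expr0 mul1r det_scalar -(exprVn rad 2) -!exprM mulnC.
Qed.

Lemma ell_startP z : dot z z <= rad ^+ 2 -> in_ell ell_start z.
Proof.
move=> zr; split=> //; rewrite /ellipsoid /= subr0 mul_mx_scalar dotZl dotZr.
by rewrite mulrA -invfM -expr2 mulrC ler_pdivrMr ?exprn_gt0// mul1r.
Qed.

(** A vector without space part in the chart is a multiple of the base point, and
    has nonzero product with the timelike vector [klein c z] unless it vanishes. *)
Lemma tail_flip_neq0 z v : dot z z < 1 -> tangent (klein c z) v -> 0 < hnorm v ->
  tail (flip c v) != 0.
Proof.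
move=> z1 yv; apply: contraTneq => t0; rewrite -leNgt.
have s0 : 0 < Num.sqrt (1 - dot z z) by rewrite sqrtr_gt0 subr_gt0.
move: yv; rewrite /tangent kleinE// minkZl mink_flip minkE hcons0 mul1r tail_hcons.
rewrite t0 dotC dot0l addr0 => /eqP.
rewrite mulf_eq0 invr_eq0 gt_eqF//= oppr_eq0 => /eqP v0.
have : mink v v = 0 by rewrite -(flip_mink c) minkE v0 t0 dot0l mul0r oppr0 addr0.
by rewrite /hnorm => ->; rewrite sqrtr0.
Qed.

(** Orthogonality of v to the query z removes the time component from the half-space
    <v, x> <= 0. *)
Lemma horoball_chart z z' v : dot z z < 1 -> dot z' z' < 1 ->
  tangent (klein c z) v -> 0 < hnorm v -> horoball (klein c z) v (klein c z') ->
  dot (tail (flip c v)) (z' - z) <= 0.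
Proof.
move=> z1 z1' yv v0 /(horoball_halfspace v0); move: yv.
have s0 : 0 < Num.sqrt (1 - dot z z) by rewrite sqrtr_gt0 subr_gt0.
have s0' : 0 < Num.sqrt (1 - dot z' z') by rewrite sqrtr_gt0 subr_gt0.
rewrite /tangent !kleinE// minkZl minkZr mink_flip -(mink_flip c v) !minkE.
rewrite !hcons0 !tail_hcons mul1r mulr1 => /eqP.
rewrite mulf_eq0 invr_eq0 gt_eqF//= pmulr_rle0 ?invr_gt0// => /eqP.
by rewrite dotDr dotNr (dotC z); lra.
Qed.

Lemma ell_sound : cut_sound ell_point ell_update (klein c) ell_growth in_ell.
Proof.
move=> i s v gs yv v0.
have N0 : 0 < 1 + n.+1%:R^-1 :> R by rewrite addr_gt0// invr_gt0.
have B0 : 0 < \det s.2 ^+ 2.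
  by apply: lt_le_trans gs; rewrite mulr_gt0// ?exprn_gt0// invr_gt0 exprn_gt0.
have Bu : s.2 \in unitmx.
  by rewrite unitmxE unitfE; apply: contraTneq B0 => ->; rewrite expr0n ltxx.
have r1 : rad ^+ 2 < 1 by rewrite expr_lt1// ltW.
set g := if dot s.1 s.1 <= rad ^+ 2 then tail (flip c v) else s.1.
have [g0 loc] : g != 0 /\ forall z, dot z z <= rad ^+ 2 ->
    horoball (ell_point s) v (klein c z) -> dot g (z - s.1) <= 0.
  rewrite /g; case: ifP => sr.
    have s1 : dot s.1 s.1 < 1 by apply: le_lt_trans r1.
    split=> [|z zr]; first exact: tail_flip_neq0 yv v0.
    by apply: horoball_chart => //; apply: le_lt_trans r1.
  move/negbT: sr; rewrite -ltNge => sr.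
  split=> [|z zr _].
    by apply: contraTneq sr => ->; rewrite dot0l -leNgt sqr_ge0.
  rewrite dotDr dotNr subr_le0; apply: le_trans (ler_norm _) _.
  rewrite -(@ler_pXn2r _ 2)// ?nnegrE ?dot_ge0// real_normK ?num_real//.
  apply: le_trans (cauchy_schwarz _ _) _.
  by rewrite expr2 ler_wpM2l ?dot_ge0// (le_trans zr)// ltW.
split=> [|z [zr ez] hz].
  rewrite /ell_growth exprS -mulrA; apply: le_trans (ell_cut_det n_gt0 g0 Bu).
  by rewrite ler_wpM2l// ltW.
by split=> //; apply: ell_cut_sub => //; exact: loc.
Qed.

(** Every n + 1 steps double the bound on det B ^ 2 (Bernoulli again), whereas
    it may grow by a factor (rad / eps)^(2 n) <= 2 ^ (2 n e) in all. *)
Lemma ell_steps (eps : R) (e : nat) z s : 0 < eps -> rad <= 2 ^+ e * eps ->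
  (forall i (b : bool), ellipsoid s (z + ((-1) ^+ b * eps) *: delta_mx 0 i)) ->
  ~ ell_growth (n.+1 * (2 * n * e).+1) s.
Proof.
move=> e0 re /(ell_det_le e0) dle gr; have := le_trans gr dle.
apply/negP; rewrite -ltNge.
have r0 : 0 < rad ^+ 2 by rewrite exprn_gt0.
have N0 : 0 < n.+1%:R :> R by [].
apply: (@lt_le_trans _ _ (2 ^+ (2 * n * e).+1 * rad ^- 2 ^+ n)); last first.
  rewrite ler_wpM2r ?exprn_ge0 ?invr_ge0 ?(ltW r0)// exprM.
  apply: lerXn2r; rewrite ?nnegrE ?exprn_ge0 ?addr_ge0 ?invr_ge0//.
  apply: le_trans (bernoulli_ineq _ _); first by rewrite mulfV ?gt_eqF//; lra.
  by rewrite (@le_trans _ _ 0)// invr_ge0 ltW.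
apply: (@le_lt_trans _ _ (2 ^+ (2 * n * e) * rad ^- 2 ^+ n)); last first.
  by rewrite ltr_pM2r ?exprn_gt0 ?invr_gt0// exprS ltr_pMl ?exprn_gt0// ltr1n.
have -> : (2 * n * e)%N = (e * 2 * n)%N by rewrite mulnC mulnA.
rewrite [2 ^+ _]exprM -exprMn; apply: lerXn2r; rewrite ?nnegrE.
- by rewrite invr_ge0 sqr_ge0.
- by rewrite mulr_ge0 ?exprn_ge0// invr_ge0 sqr_ge0.
rewrite ler_pdivlMr// mulrC ler_pdivrMr ?exprn_gt0// exprM -exprMn.
by apply: lerXn2r; rewrite ?nnegrE ?mulr_ge0 ?exprn_ge0// ltW.
Qed.

End EllipsoidPhase.

(** The region is used only for points better than b, so the hypothesis that x is
    near c may be conditional. *)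
Lemma ell_phase (R : realType) n (c : hspace R n) (f : hspace R n -> R)
    (L sigma delta : R) (e : nat) (x : hspace R n) (b : hspace R n * R) m z :
  (0 < n)%N -> 0 < sigma -> sigma <= 1 / 4 -> 0 < delta -> delta < 1 / 2 ->
  0 <= L -> hlipschitz L f -> b.2 = f b.1 ->
  (f x < b.2 -> mink c x ^+ 2 - 1 <= sigma ^+ 2) ->
  let rad := sigma + delta / 4 in
  rad <= 2 ^+ e * (delta / 4) ->
  alg_run f (cutting (ell_point c) (ell_update c rad) (n.+1 * (2 * n * e).+1)
    (ell_start rad) b (fun _ b => Output b.1)) m z ->
  m = (n.+1 * (2 * n * e).+1)%N /\ f z <= f x + L * delta.
Proof.
move=> n0 s0 s1 d0 d1 L0 Lf bf cxb rad re run.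
have e0 : 0 < delta / 4 by rewrite divr_gt0.
have e1 : delta / 4 <= 1 / 8 by lra.
have r0 : 0 < rad by rewrite addr_gt0.
have r1 : rad <= 3 / 8 by rewrite /rad; lra.
have r2 : rad ^+ 2 <= 1 / 4 by rewrite expr2; nra.
have rlt1 : rad < 1 by lra.
have [s [b' [m' [-> run' b'f bb' h]]]] :=
  cutting_run (ell_sound (c := c) n0 r0 rlt1) bf (or_intror (ell_start_growth _)) run.
inversion run'; subst; split; first by rewrite addn0.
rewrite -b'f; have Ld : 0 <= L * delta by rewrite mulr_ge0// ltW.
case: h => [h|[gr loc]]; first by rewrite (le_trans (h x))// lerDl.
rewrite leNgt; apply/negP => fx.
have cx : mink c x ^+ 2 - 1 <= sigma ^+ 2.
  by apply: cxb; apply: lt_le_trans bb'; apply: le_lt_trans fx; rewrite lerDl.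
have [w xw ww] := klein_surj c x.
have w2 : dot w w <= sigma ^+ 2.
  apply: le_trans cx; rewrite ww; have := mink_ge1 c x.
  move=> X1; have Y1 : 1 <= mink c x ^+ 2 by rewrite -sqrrN expr_ge1// (le_trans _ X1).
  move: (mink c x ^+ 2) Y1 => Y Y1; have Y0 : 0 < Y by apply: lt_le_trans Y1.
  have : 0 <= (Y - 1) ^+ 2 / Y by rewrite divr_ge0 ?sqr_ge0// ltW.
  have -> : (Y - 1) ^+ 2 / Y = Y - 2 + Y^-1 by field; rewrite gt_eqF.
  lra.
apply: (ell_steps (z := w) r0 e0 re _ gr) => i bb.
set k := (-1) ^+ bb * (delta / 4); set d := delta_mx 0 i.
have k2 : k ^+ 2 = (delta / 4) ^+ 2 by rewrite /k exprMn sqrr_sign mul1r.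
have dd : dot d d = 1 :> R.
  rewrite dotE (bigD1 i)//= big1 => [|j ji]; rewrite !mxE !eqxx /= ?eqxx ?mulr1 ?addr0//.
  by rewrite (negPf ji) mulr0.
clearbody k d.
have wd : `|k * dot w d| <= (delta / 4) * sigma.
  rewrite -(@ler_pXn2r _ 2) ?nnegrE ?(mulr_ge0 (ltW e0) (ltW s0))//.
  rewrite real_normK ?num_real// exprMn k2 [leRHS]exprMn ler_wpM2l ?sqr_ge0//.
  by apply: le_trans (cauchy_schwarz _ _) _; rewrite dd mulr1.
have wr : dot (w + k *: d) (w + k *: d) <= rad ^+ 2.
  rewrite !dot_lin (dotC d w) dd mulr1 -expr2 k2 /rad.
  by move: wd; rewrite ler_norml => /andP[_]; lra.
suff : in_ell rad s (w + k *: d) by case.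
apply: loc; first exact: ell_startP.
apply: le_lt_trans fx.
have := Lf (klein c (w + k *: d)) x; rewrite ler_norml => /andP[_ h].
have hd : hdist (klein c (w + k *: d)) x <= delta.
  rewrite xw; apply: le_trans (klein_dist _ _ _) _; first exact: le_trans r2.
    by apply: le_trans w2 _; nra.
  rewrite addrAC subrr add0r !dot_lin dd mulr1 -expr2 k2 sqrtr_sqr ger0_norm ?(ltW e0)//.
  by lra.
have := ler_wpM2l L0 hd; lra.
Qed.

(** * Counting queries *)

Section Budget.
Context {R : realType}.
Implicit Types (r delta : R) (n j e : nat).

Definition budget n r delta : R := Num.max 1 (ln r + n%:R ^+ 2 * ln (1 / delta)).

Lemma budget_ge1 n r delta : 1 <= budget n r delta.
Proof. by rewrite /budget le_max lexx. Qed.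

Lemma ln2_gt0 : 0 < ln (2 : R). Proof. by rewrite ln_gt0// ltr1n. Qed.

Lemma ball_steps_budget n r delta j : 0 < r -> 0 < delta -> delta < 1 ->
  2 ^+ j <= 2 * Num.max 1 r -> j%:R <= (1 + (ln 2)^-1) * budget n r delta.
Proof.
move=> r0 d0 d1 jr; have l0 := ln2_gt0; have M1 := budget_ge1 n r delta.
have D0 : 0 <= ln (1 / delta) by rewrite ln_ge0// ler_pdivlMr// mul1r ltW.
have m0 : 0 < Num.max 1 r by rewrite lt_max ltr01.
have lm : ln (Num.max 1 r) <= budget n r delta.
  case: (leP 1 r) => _; last by rewrite ln1 (le_trans ler01).
  by rewrite /budget le_max lerDl mulr_ge0 ?sqr_ge0 ?orbT.
have : ln (2 ^+ j) <= ln (2 * Num.max 1 r).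
  by rewrite ler_ln ?posrE ?exprn_gt0 ?mulr_gt0.
rewrite lnXn// lnM ?posrE// -[ln 2 *+ j]mulr_natl => h.
rewrite -(ler_pM2r l0); apply: le_trans h _.
rewrite mulrAC mulrDl mul1r mulVf ?gt_eqF// mulrDl mul1r lerD//.
by rewrite -[leLHS]mulr1 ler_pM2l.
Qed.

(** Unoptimized; 3 ln 2 + 4 over 3 ln 2 bounds n^2 against the budget, and 18 is the
    constant in the hypothesis on e of [ell_steps_budget]. *)
Definition ell_const : R :=
  (4 * ((3 * ln 2 + 4) / (3 * ln 2)) * (ln 18 + ln 2) + 4) / ln 2.

(** With rho = min 1 r / delta, the cost is a multiple of n^2 (1 + ln rho).  Here
    n^2 ln rho is within the budget because n^2 ln r <= ln r for r <= 1, and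
    n^2 itself is because, for n >= 2, ln r > - ln (1 / delta) leaves at least
    3/4 of n^2 ln (1 / delta), and ln (1 / delta) >= ln 2. *)
Lemma ell_steps_budget n r delta e : (0 < n)%N -> 0 < delta -> delta < 1 / 2 ->
  delta < r -> 2 ^+ e <= 18 * (Num.min 1 r / delta) ->
  (n.+1 * (2 * n * e).+1)%:R <= ell_const * budget n r delta.
Proof.
move=> n0 d0 d1 dr er; have l0 := ln2_gt0; have M1 := budget_ge1 n r delta.
have r0 : 0 < r by apply: lt_trans dr.
set M := budget n r delta in M1 *; set D := ln (1 / delta).
have MT : ln r + n%:R ^+ 2 * D <= M by rewrite /M /budget le_max lexx orbT.
have N1 : 1 <= n%:R :> R by rewrite ler1n.
have N2 : 1 <= n%:R ^+ 2 :> R by rewrite expr_ge1.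
have Dl : ln 2 <= D.
  by rewrite ler_ln ?posrE ?divr_gt0// ler_pdivlMr//; lra.
have rD : - D <= ln r.
  by rewrite /D mul1r lnV ?posrE// opprK ler_ln ?posrE// ltW.
have n2M : 3 * ln 2 * n%:R ^+ 2 <= (3 * ln 2 + 4) * M.
  have lM : 0 <= ln 2 * (M - 1) by rewrite mulr_ge0 ?subr_ge0// ltW.
  have [n1|n1] := leqP n 1.
    have -> : n = 1%N by apply/eqP; rewrite eqn_leq n1 n0.
    by rewrite expr1n; lra.
  have N4 : 4 <= n%:R ^+ 2 :> R by rewrite -natrX ler_nat (@leq_exp2r 2 n 2).
  have D0 : 0 <= D by lra.
  have : 0 <= (n%:R ^+ 2 - 4) * D by rewrite mulr_ge0 ?subr_ge0.
  have : 0 <= n%:R ^+ 2 * (D - ln 2) by rewrite mulr_ge0 ?subr_ge0 ?sqr_ge0.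
  lra.
pose m : R := Num.min 1 r; have m0 : 0 < m by rewrite lt_min ltr01.
have nm : n%:R ^+ 2 * (ln m + D) <= M.
  apply: le_trans MT; rewrite mulrDr lerD2r /m; case: (leP 1 r) => r1.
    by rewrite ln1 mulr0 ln_ge0.
  have : 0 <= (n%:R ^+ 2 - 1) * (- ln r); last by lra.
  by rewrite mulr_ge0 ?subr_ge0 ?oppr_ge0 ?ln_le0 ?(ltW r1).
have : ln (2 ^+ e) <= ln (18 * (m / delta)).
  by rewrite ler_ln ?posrE ?exprn_gt0 ?mulr_gt0 ?invr_gt0.
have -> : ln (18 * (m / delta)) = ln 18 + (ln m + D).
  by rewrite lnM ?posrE ?divr_gt0// [ln (m / delta)]lnM ?posrE ?invr_gt0// /D mul1r.
rewrite lnXn// -[ln 2 *+ e]mulr_natl => eD.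
have cnt : (n.+1 * (2 * n * e).+1)%:R <= 4 * n%:R ^+ 2 * (e%:R + 1) :> R.
  have -> : 4 * n%:R ^+ 2 * (e%:R + 1) = (2 * n)%:R * (2 * n * e.+1)%:R :> R.
    by rewrite !natrM -natr1; ring.
  rewrite -natrM ler_nat; apply: leq_mul; first by rewrite mul2n -addnn -addn1 leq_add2l.
  by rewrite mulnS -add1n leq_add2r muln_gt0.
apply: le_trans cnt _.
rewrite /ell_const -(ler_pM2r l0) [leRHS]mulrAC divfK ?gt_eqF//.
have n20 : 0 <= n%:R ^+ 2 :> R by rewrite sqr_ge0.
have h1 : n%:R ^+ 2 * (e%:R * ln 2) <= n%:R ^+ 2 * (ln 18 + (ln m + D)).
  by rewrite ler_wpM2l.
have l18 : 0 <= ln 18 + ln 2 :> R by rewrite addr_ge0 ?ln_ge0 ?ler1n.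
have h2 : n%:R ^+ 2 * (ln 18 + ln 2) <=
    (3 * ln 2 + 4) / (3 * ln 2) * M * (ln 18 + ln 2).
  by rewrite ler_wpM2r// mulrAC ler_pdivlMr ?mulr_gt0// mulrC.
move: h1 h2 nm; move: (ln 18) (ln m + D) ((3 * ln 2 + 4) / (3 * ln 2)) (n%:R ^+ 2).
by move=> u v w k; lra.
Qed.

Lemma ell_const_ge0 : 0 <= ell_const.
Proof.
have l0 := ltW ln2_gt0; have l18 : 0 <= ln (18 : R) by rewrite ln_ge0 ?ler1n.
have l3 : 0 <= 3 * ln 2 :> R by apply: mulr_ge0.
apply: divr_ge0 => //; apply: addr_ge0 => //; apply: mulr_ge0; last exact: addr_ge0.
by apply: mulr_ge0 => //; apply: divr_ge0 => //; apply: addr_ge0.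
Qed.

End Budget.

(** * Putting the two phases together *)

(** In dimension 0 the hyperboloid is a single point. *)
Lemma centre_close (R : realType) n (p : hspace R n) (r delta L : R) f xs :
  0 <= L -> 0 < delta -> hlipschitz L f -> hball p r xs ->
  (n == 0)%N || (r <= delta) -> f p - f xs <= L * delta.
Proof.
move=> L0 d0 Lf xr /orP[/eqP n0|rd]; last first.
  have := Lf p xs; rewrite ler_norml => /andP[_ /le_trans]; apply.
  by rewrite ler_wpM2l// (le_trans xr).
subst n; have -> : xs = p; last by rewrite subrr mulr_ge0// ltW.
have h0 (y : hspace R 0) : y 0 ord0 = 1.
  have := hcoord_sqr y; rewrite dotE big_ord0 addr0 => /eqP.
  rewrite sqrf_eq1 => /orP[/eqP//|/eqP y1].
  by have := hpos y; rewrite y1; lra.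
by apply/val_inj/rowP => i; rewrite /= !ord1 !h0.
Qed.

(** The bound 2 r on the radius matters only in dimension 1, where the second phase
    may not restart from a constant radius when r is small. *)
Lemma ball_phase (R : realType) n (p : hspace R n) (f : hspace R n -> R)
    (r : R) (N : nat) xs b k m z :
  0 < r -> hball p r xs -> iter N shrink (cosh r) <= 65 / 64 -> b.2 = f b.1 ->
  alg_run f (cutting ball_point ball_update N (p, cosh r) b k) m z ->
  exists s b' m', [/\ m = (N + m')%N, alg_run f (k s b') m' z, b'.2 = f b'.1 &
    f xs < b'.2 -> mink s.1 xs ^+ 2 - 1 <= (Num.min (1 / 4) (2 * r)) ^+ 2].
Proof.
move=> r0 xr KN bf run; have K1 := cosh_ge1 r.
have inv0 : (forall x, b.2 <= f x) \/ (p, cosh r).2 = iter 0 shrink (cosh r) by right.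
have [s [b' [m' [mE run' bf' _ h]]]] := cutting_run (ball_sound K1) bf inv0 run.
exists s, b', m'; split=> // fx.
have xs0 : - mink p xs <= cosh r by apply: le_cosh_arcosh => //; exact: mink_ge1.
case: h => [h|[sK loc]]; first by move: fx; rewrite ltNge h.
have := loc xs xs0 fx; rewrite /in_ball /= sK add0n => Xs.
have X1 := mink_ge1 s.1 xs; rewrite -sqrrN.
have X3 : - mink s.1 xs <= cosh r by apply: le_trans Xs (iter_shrink_le _ K1).
have {}Xs : - mink s.1 xs <= 65 / 64 by apply: le_trans KN.
move: (- mink s.1 xs) X1 Xs X3 => X X1 Xs X3.
case: (leP (1 / 4) (2 * r)) => r4.
  apply: (@le_trans _ _ ((65 / 64) ^+ 2 - 1)); last by lra.
  by rewrite lerD2r lerXn2r// ?nnegrE ?(le_trans _ X1)//; lra.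
apply: (@le_trans _ _ (cosh r ^+ 2 - 1)); last by apply: cosh_small; lra.
by rewrite lerD2r lerXn2r// ?nnegrE ?(le_trans _ X1)//; lra.
Qed.

Lemma close_centre (R : realType) n (c xs : hspace R n) (f : hspace R n -> R)
    (L delta : R) (b : hspace R n * R) :
  0 <= L -> hlipschitz L f -> 1 / 2 <= delta -> b.2 = f b.1 ->
  (f xs < b.2 -> mink c xs ^+ 2 - 1 <= (1 / 4) ^+ 2) ->
  f (if f c <= b.2 then c else b.1) <= f xs + L * delta.
Proof.
move=> L0 Lf d2 bf h.
set best := if _ then _ else _.
have best1 : f best <= f c.
  by rewrite /best; case: (leP (f c) b.2) => //= +; rewrite -bf; exact: ltW.
have best2 : f best <= b.2 by rewrite /best; case: (leP (f c) b.2) => //= _; rewrite bf.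
have Ld : 0 <= L * delta by rewrite mulr_ge0//; lra.
have [fx|fx] := ltP (f xs) b.2; last by rewrite (le_trans best2)// (le_trans fx)// lerDl.
have hd : hdist c xs <= delta.
  apply: le_trans d2; rewrite (_ : 1 / 2 = 2 * (1 / 4)); last by field.
  by apply: arcosh_le2; rewrite ?sqrrN ?mink_ge1 ?h// divr_ge0.
have := Lf c xs; rewrite ler_norml => /andP[_ fsx].
have := ler_wpM2l L0 hd; lra.
Qed.

Theorem proposition9 (R : realType) :
  exists C : R, 0 < C /\
  forall (n : nat) (p : hspace R n) (r delta : R),
    0 < r -> 0 < delta -> delta < 1 ->
  exists A : algorithm R n,
  forall (L : R) (f : hspace R n -> R) (fstar : R),
    0 <= L -> hconvex f -> hlipschitz L f ->
    is_minimum (f @` hball p r) fstar ->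
  forall (m : nat) (x : hspace R n),
    alg_run f A m x ->
    m%:R <= C * Num.max 1 (ln r + n%:R ^+ 2 * ln (1 / delta)) /\
    f x - fstar <= L * delta.
Proof.
have [N0 N0P] := @shrink_steps R.
have l0 := @ln2_gt0 R; have c0 := @ell_const_ge0 R.
pose C1 : R := 1 + (ln 2)^-1.
have C10 : 0 <= C1 by rewrite addr_ge0// invr_ge0 ltW.
have N00 : 0 <= N0%:R :> R by [].
exists (2 + N0%:R + C1 + ell_const); split; first by lra.
move=> n p r delta r0 d0 d1.
have M1 := budget_ge1 n r delta; have M0 : 0 <= budget n r delta by apply: le_trans M1.
rewrite -/(budget n r delta).
have [triv|] := boolP ((n == 0)%N || (r <= delta)).
  exists (Output p) => L f fstar L0 _ Lf [[xs xr <-] _] m x run.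
  inversion run; subst; split; last exact: centre_close triv.
  by apply: mulr_ge0 => //; lra.
rewrite negb_or -ltNge -lt0n => /andP[n0 dr].
have max1 : 1 <= Num.max 1 r by rewrite le_max lexx.
have [j /andP[jr jr2]] := pow2_between max1.
have {}jr : r <= 2 ^+ j by apply: le_trans jr; rewrite le_max lexx orbT.
have jM : j%:R <= C1 * budget n r delta := ball_steps_budget n r0 d0 d1 jr2.
have KN := N0P r j (ltW r0) jr.
(* The two bounds on the radius after the ball phase: the constant of the 65/64
   threshold, and the original radius. *)
pose sigma := Num.min (1 / 4) (2 * r).
have sg0 : 0 < sigma by rewrite lt_min !mulr_gt0// invr_gt0.
have sg1 : sigma <= 1 / 4 by rewrite ge_min lexx.
pose rad := sigma + delta / 4.
have e0 : 0 < delta / 4 by rewrite divr_gt0.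
have [e /andP[er er2]] : exists e, rad / (delta / 4) <= 2 ^+ e <= 2 * (rad / (delta / 4)).
  by apply: pow2_between; rewrite ler_pdivlMr// mul1r lerDr ltW.
rewrite ler_pdivrMr// in er.
pose steps := (n.+1 * (2 * n * e).+1)%N.
(* The first query only provides a best value to start from. *)
exists (Query p (fun fp _ =>
  cutting ball_point ball_update (j + N0) (p, cosh r) (p, fp) (fun s b =>
    if 1 / 2 <= delta then
      Query s.1 (fun fc _ => Output (if fc <= b.2 then s.1 else b.1))
    else cutting (ell_point s.1) (ell_update s.1 rad) steps (ell_start rad) b
           (fun _ b' => Output b'.1)))).
move=> L f fstar L0 _ Lf [[xs xr <-] _] m z run.
inversion run as [|? ? v m1 z' sub run1 ex em ez]; subst.
have [s [b [m2 [-> run2 bf h]]]] :=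
  ball_phase r0 xr KN (erefl : (p, f p).2 = f (p, f p).1) run1.
rewrite lerBlDl.
clearbody C1.
have jN : (j + N0).+1%:R <= (1 + N0%:R + C1) * budget n r delta.
  have : 0 <= N0%:R * (budget n r delta - 1) by rewrite mulr_ge0 ?subr_ge0.
  by rewrite -natr1 natrD; lra.
have cM : 0 <= ell_const * budget n r delta by rewrite mulr_ge0.
case: ifP run2 => [d2 run2|/negbT].
  inversion run2 as [|? ? v' m3 z'' sub' run3 ex' em' ez']; subst.
  inversion run3; subst; split.
    by rewrite -addSn natrD; lra.
  apply: close_centre => // fx; apply: le_trans (h fx) _.
  by rewrite lerXn2r ?nnegrE ?(ltW sg0)//; lra.
rewrite -ltNge => d2 run2.
have [-> fz] := ell_phase n0 sg0 sg1 d0 d2 L0 Lf bf h er run2.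
split=> //; rewrite -addSn natrD.
have : steps%:R <= ell_const * budget n r delta.
  apply: ell_steps_budget => //; apply: le_trans er2 _.
  have dm : delta < Num.min 1 r by rewrite lt_min d1.
  have sm : sigma <= 2 * Num.min 1 r.
    rewrite /sigma; case: (leP 1 r) => r1; last by rewrite ge_min lexx orbT.
    by rewrite ge_min; apply/orP; left; lra.
  rewrite [leRHS]mulrA ler_pdivlMr//.
  (* rad / (delta / 4) <= 1 + 8 rho <= 9 rho, and rounding up to a power of 2 doubles
     it: hence the constant 18. *)
  have -> : 2 * (rad / (delta / 4)) * delta = 8 * sigma + 2 * delta.
    by rewrite /rad; field; rewrite gt_eqF.
  by lra.
by rewrite -/steps; lra.
Qed.
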